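(* Let $\mathcal V$ be a quantale, $F\colon\mathsf{Set}\to\mathsf{Set}$ a functor, and $\widehat F$ a lax extension of $F$ to $\mathcal V\text{-}\mathsf{Rel}$. If $\lambda$ is a regular cardinal such that the inclusion natural transformation $F_\lambda\hookrightarrow F$ is dense with respect to $\widehat F$, then $\widehat F$ is $\lambda$-small.
   Context: A quantale $\mathcal V$ is a complete lattice with a commutative monoid structure $(\otimes,k)$ such that each $u\otimes-$ preserves suprema; $\hom(u,-)$ denotes the right adjoint of $u\otimes -$. A $\mathcal V$-relation $r\colon X\nrightarrow Y$ is a map $X\times Y\to\mathcal V$. For $r\colon X\nrightarrow Y$, $s\colon Y\nrightarrow Z$, the composite is $(s\cdot r)(x,z)=\bigvee_{y}r(x,y)\otimes s(y,z)$; $1_X$ has value $k$ on the diagonal and $\bot$ elsewhere; $\mathcal V\text{-}\mathsf{Rel}$ is the category of sets and $\mathcal V$-relations. $\mathcal V$-relations are ordered pointwise; $r^\circ(y,x)=r(x,y)$ is the converse. A function $f\colon X\to Y$ is regarded as the $\mathcal V$-relation with value $k$ on the graph of $f$ and $\bot$ elsewhere. For $q\colon Z\nrightarrow Y$ and $r\colon X\nrightarrow Y$, the lift $q\backslash r\colon X\nrightarrow Z$ is $(q\backslash r)(x,z)=\bigwedge_{y}\hom(q(z,y),r(x,y))$. A lax extension of $F$ to $\mathcal V\text{-}\mathsf{Rel}$ is an assignment $(r\colon X\nrightarrow Y)\mapsto(\widehat Fr\colon FX\nrightarrow FY)$ such that (L1) $r\le r'$ implies $\widehat Fr\le\widehat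 Fr'$; (L2) $\widehat Fs\cdot\widehat Fr\le\widehat F(s\cdot r)$; (L3) $Ff\le\widehat Ff$ and $(Ff)^\circ\le\widehat F(f^\circ)$ for all functions $f$. $F_\lambda$ is the subfunctor of $F$ with $F_\lambda X=\bigcup\{Fi[FY]\mid i\colon Y\to X\text{ a subset inclusion},\ |Y|<\lambda\}$. A $\mathcal V$-category $(X,a)$ is a set $X$ with $a\colon X\nrightarrow X$ satisfying $1_X\le a$ and $a\cdot a\le a$. A map $i\colon A\to X$ is dense in $(X,a)$ if $a=a\cdot i\cdot i^\circ\cdot a$. A natural transformation $i\colon G\to F$ is dense with respect to $\widehat F$ if for each set $X$ the map $i_X\colon GX\to FX$ is dense in the $\mathcal V$-category $(FX,\widehat F1_X)$. For a cardinal $\kappa$, a $\kappa$-ary predicate lifting $\mu$ for $F$ is a family of maps sending $r\colon X\nrightarrow\kappa$ to $\mu(r)\colon FX\nrightarrow1$ with $\mu(r\cdot f)=\mu(r)\cdot Ff$ for all functions $f\colon X\to Y$ and $r\colon Y\nrightarrow\kappa$. It is monotone if $r\le r'$ implies $\mu(r)\le\mu(r')$. For monotone $\mu$, $\widehat F^\mu r=\bigwedge_{g\colon Y\nrightarrow\kappa}\mu(g)\backslash\mu(g\cdot r)$ for $r\colon X\nrightarrow Y$; for a class $M$ of monotone predicate liftings, the Kantorovich extension is $\widehat F^M=\bigwedge_{\mu\in M}\widehat F^\mu$. $\widehat F$ is $\lambda$-small if $\widehat F=\widehat F^M$ for some set $M$ of monotone predicate liftings each of arity $\kappa<\lambda$.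 *)

(* Defs.v *)
From HB Require Import structures.
From mathcomp Require Import all_boot all_order.
From mathcomp Require Import boolp classical_sets functions cardinality.

Set Implicit Arguments.
Unset Strict Implicit.
Unset Printing Implicit Defensive.

Import Order.TTheory.
Local Open Scope classical_set_scope.
Local Open Scope order_scope.

Reserved Notation "u ⊗ v" (at level 40, left associativity).
Reserved Notation "s ∙ r" (at level 40, left associativity).
Reserved Notation "r ^∘" (at level 1, format "r ^∘").
Reserved Notation "r ⊑ s" (at level 70, no associativity).
Reserved Notation "q ⧵ r" (at level 40, left associativity).

(* The category of sets is the category of types in one fixed universe, the one
   that this definition introduces. A small set is a type in [SET]; functors,
   predicate liftings and lax extensions live one universe above. *)
Definition SET := Type.

HB.mixin Record isQuantale d V of Order.POrder d V := {
  tensor : V -> V -> V;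
  kunit : V;
  qsup : set V -> V;
  qsup_supremum : forall A : set V, supremums A (qsup A);
  tensorA : associative tensor;
  tensorC : commutative tensor;
  tensor1q : left_id kunit tensor;
  tensor_qsup : forall (u : V) (A : set V),
    tensor u (qsup A) = qsup (tensor u @` A)
}.

#[short(type="quantaleType")]
HB.structure Definition Quantale d :=
  { V of isQuantale d V & Order.POrder d V }.

Notation "u ⊗ v" := (tensor u v).

Section QuantaleOps.
Context {d : Order.disp_t} {V : quantaleType d}.
Implicit Types (u v w : V) (A : set V).

Definition qbot : V := qsup set0.

Definition qinf A : V := qsup (lbound A).

Definition qhom u w : V := qsup [set v | u ⊗ v <= w].

Lemma qsup_ub A u : A u -> u <= qsup A.
Proof. by case: (qsup_supremum A) => + _; apply. Qed.

Lemma qsup_le A u : ubound A u -> qsup A <= u.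
Proof. by case: (qsup_supremum A) => _; apply. Qed.

Lemma qinf_infimum A : infimums A (qinf A).
Proof.
split=> [u Au|u]; last exact: qsup_ub.
by apply: qsup_le => v; apply.
Qed.

Lemma tensor_mono u v w : v <= w -> u ⊗ v <= u ⊗ w.
Proof.
move=> vw; have -> : w = qsup [set v; w].
  apply/le_anti/andP; split; first by apply: qsup_ub; right.
  by apply: qsup_le => x [->|->].
by rewrite tensor_qsup; apply: qsup_ub; exists v => //; left.
Qed.

Lemma qhom_adjoint u v w : (u ⊗ v <= w) = (v <= qhom u w).
Proof.
apply/idP/idP => [|vh]; first exact: qsup_ub.
apply: le_trans (tensor_mono u vh) _.
by rewrite tensor_qsup; apply: qsup_le => _ [x /= xw <-].
Qed.

End QuantaleOps.

Definition vrel (V : Type) (X Y : SET) := X -> Y -> V.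

Section VRel.
Context {d : Order.disp_t} {V : quantaleType d}.
Implicit Types X Y Z : SET.

Definition vle X Y (r s : vrel V X Y) := forall x y, r x y <= s x y.

Definition vcomp X Y Z (s : vrel V Y Z) (r : vrel V X Y) : vrel V X Z :=
  fun x z => qsup (range (fun y => r x y ⊗ s y z)).

Definition vid X : vrel V X X := fun x y => if `[< x = y >] then kunit else qbot.

Definition vgraph X Y (f : X -> Y) : vrel V X Y :=
  fun x y => if `[< f x = y >] then kunit else qbot.

Definition vconv X Y (r : vrel V X Y) : vrel V Y X := fun y x => r x y.

Definition vlift X Y Z (q : vrel V Z Y) (r : vrel V X Y) : vrel V X Z :=
  fun x z => qinf (range (fun y => qhom (q z y) (r x y))).

End VRel.

Notation "r ⊑ s" := (vle r s).
Notation "s ∙ r" := (vcomp s r).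
Notation "r ^∘" := (vconv r).
Notation "q ⧵ r" := (vlift q r).
Arguments vgraph {d} V {X Y} f.
Arguments vid {d} V X.

Record setFunctor := SetFunctor {
  fobj :> SET -> SET;
  fmap : forall X Y : SET, (X -> Y) -> fobj X -> fobj Y;
  fmap_id : forall X : SET, fmap (@id X) = id;
  fmap_comp : forall (X Y Z : SET) (f : X -> Y) (g : Y -> Z),
    fmap (g \o f) = fmap g \o fmap f
}.
Arguments fmap F {X Y} f : rename.

Record natTrans (G F : setFunctor) := NatTrans {
  nt_map : forall X : SET, G X -> F X;
  nt_natural : forall (X Y : SET) (f : X -> Y),
    @nt_map Y \o fmap G f = fmap F f \o @nt_map X
}.
Arguments nt_map {G F} i X : rename.

Record laxExtension d (V : quantaleType d) (F : setFunctor) := LaxExtension {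
  lax_map : forall X Y : SET, vrel V X Y -> vrel V (F X) (F Y);
  lax_mono : forall (X Y : SET) (r r' : vrel V X Y),
    r ⊑ r' -> lax_map r ⊑ lax_map r';
  lax_comp : forall (X Y Z : SET) (r : vrel V X Y) (s : vrel V Y Z),
    lax_map s ∙ lax_map r ⊑ lax_map (s ∙ r);
  lax_graph : forall (X Y : SET) (f : X -> Y),
    vgraph V (fmap F f) ⊑ lax_map (vgraph V f);
  lax_cograph : forall (X Y : SET) (f : X -> Y),
    (vgraph V (fmap F f))^∘ ⊑ lax_map ((vgraph V f)^∘)
}.
Arguments lax_map {d V F} Fhat {X Y} r : rename.

(* A cardinal is given by any set of that cardinality. *)
Definition card_lt (T U : Type) (A : set T) (B : set U) : bool :=
  (A #<= B)%card && ~~ (B #<= A)%card.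

Definition smaller (K L : SET) : bool := card_lt [set: K] [set: L].

Definition regular (L : SET) : Prop :=
  infinite_set [set: L] /\
  forall (I T : SET) (A : I -> set T),
    smaller I L -> (forall i, card_lt (A i) [set: L]) ->
    card_lt (\bigcup_i A i) [set: L].

Section SmallSubfunctor.
Variables (F : setFunctor) (L : SET).

Definition small_part (X : SET) : set (F X) :=
  [set x | exists2 A : set X, card_lt A [set: L] &
           range (fmap F (fun a : {a | A a} => sval a)) x].

Lemma card_lt_image (X Y : Type) (f : X -> Y) (A : set X) (B : set L) :
  card_lt A B -> card_lt (f @` A) B.
Proof.
case/andP=> AB BA; apply/andP; split.
  exact: card_le_trans (card_image_le f A) AB.
by apply: contra BA => /card_le_trans; apply; exact: card_image_le.
Qed.

Lemma small_part_fmap (X Y : SET) (f : X -> Y) (x : F X) :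
  small_part x -> small_part (fmap F f x).
Proof.
case=> A AL [t _ <-]; exists (f @` A); first exact: card_lt_image.
pose g (a : {a | A a}) : {b | (f @` A) b} :=
  exist _ (f (sval a)) (imageP f (svalP a)).
exists (fmap F g t) => //.
by rewrite -[LHS]/((fmap F _ \o fmap F g) t) -[RHS]/((fmap F f \o fmap F _) t)
  -!fmap_comp.
Qed.

Definition small_obj (X : SET) : SET := {x : F X | small_part x}.

Definition small_fmap (X Y : SET) (f : X -> Y) (x : small_obj X) :
    small_obj Y :=
  exist _ (fmap F f (sval x)) (small_part_fmap f (svalP x)).

Lemma small_fmap_id (X : SET) : small_fmap (@id X) = id.
Proof. by apply/funext => -[x p]; apply: eq_exist => /=; rewrite fmap_id. Qed.

Lemma small_fmap_comp (X Y Z : SET) (f : X -> Y) (g : Y -> Z) :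
  small_fmap (g \o f) = small_fmap g \o small_fmap f.
Proof. by apply/funext => -[x p]; apply: eq_exist => /=; rewrite fmap_comp. Qed.

Definition small_subfunctor : setFunctor :=
  SetFunctor small_fmap_id small_fmap_comp.

Definition small_inclusion : natTrans small_subfunctor F :=
  @NatTrans small_subfunctor F (fun X x => sval x) (fun X Y f => erefl).

End SmallSubfunctor.

Record vcat d (V : quantaleType d) := VCat {
  vobj : SET;
  vhom : vrel V vobj vobj;
  vcat_id : vid V vobj ⊑ vhom;
  vcat_comp : vhom ∙ vhom ⊑ vhom
}.
Arguments vhom {d V} C : rename.

Definition dense d (V : quantaleType d) (A : SET) (C : vcat V) (i : A -> vobj C) :=
  vhom C = vhom C ∙ vgraph V i ∙ (vgraph V i)^∘ ∙ vhom C.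

Section LaxCategory.
Context {d : Order.disp_t} {V : quantaleType d} {F : setFunctor}.
Variables (Fhat : laxExtension V F) (X : SET).

Lemma lax_vcat_id : vid V (F X) ⊑ lax_map Fhat (vid V X).
Proof. by have := lax_graph Fhat (@id X); rewrite fmap_id. Qed.

Lemma vcomp_vid : vid V X ∙ vid V X ⊑ vid V X.
Proof.
move=> x z; apply: qsup_le => _ [y _ <-]; rewrite /vid.
case: asboolP => [->|_]; first by rewrite tensor1q.
by rewrite tensorC tensor_qsup image_set0; apply: qsup_le.
Qed.

Lemma lax_vcat_comp : lax_map Fhat (vid V X) ∙ lax_map Fhat (vid V X) ⊑ lax_map Fhat (vid V X).
Proof.
move=> x z; apply: le_trans (lax_comp Fhat _ _ x z) _.
exact: lax_mono vcomp_vid _ _.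
Qed.

Definition lax_vcat : vcat V := VCat lax_vcat_id lax_vcat_comp.

End LaxCategory.

Definition dense_nat d (V : quantaleType d) (G F : setFunctor)
    (i : natTrans G F) (Fhat : laxExtension V F) :=
  forall X : SET, dense (C := lax_vcat Fhat X) (nt_map i X).

Record predLifting d (V : quantaleType d) (F : setFunctor) := PredLifting {
  arity : SET;
  pl_map : forall X : SET, vrel V X arity -> vrel V (F X) unit;
  pl_natural : forall (X Y : SET) (f : X -> Y) (r : vrel V Y arity),
    pl_map (r ∙ vgraph V f) = pl_map r ∙ vgraph V (fmap F f)
}.
Arguments pl_map {d V F} mu {X} r : rename.

Section Kantorovich.
Context {d : Order.disp_t} {V : quantaleType d} {F : setFunctor}.

Definition monotone (mu : predLifting V F) :=
  forall (X : SET) (r r' : vrel V X (arity mu)), r ⊑ r' -> pl_map mu r ⊑ pl_map mu r'.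

Definition kantorovich1 (mu : predLifting V F) (X Y : SET) (r : vrel V X Y) :
    vrel V (F X) (F Y) :=
  fun x y => qinf (range (fun g : vrel V Y (arity mu) =>
                            (pl_map mu g ⧵ pl_map mu (g ∙ r)) x y)).

Definition kantorovich (M : set (predLifting V F)) (X Y : SET)
    (r : vrel V X Y) : vrel V (F X) (F Y) :=
  fun x y => qinf ((fun mu => kantorovich1 mu r x y) @` M).

(* [predLifting V F] is a proper class relative to [SET]; the classes of
   predicate liftings that are sets are those indexed by a type in [SET]. *)
Definition is_set (M : set (predLifting V F)) :=
  exists (I : SET) (mu : I -> predLifting V F), M = range mu.

Definition lambda_small (L : SET) (Fhat : laxExtension V F) :=
  exists M : set (predLifting V F),
    [/\ is_set M,
        forall mu, M mu -> monotone mu /\ smaller (arity mu) L &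
        forall (X Y : SET) (r : vrel V X Y), lax_map Fhat r = kantorovich M r].

End Kantorovich.

(* Main.v *)
Require Import Defs.
From mathcomp Require Import all_boot all_order.
From mathcomp Require Import boolp classical_sets functions cardinality.

(** The liftings that recover [Fhat] are the Moss liftings: every [t : F K]
    induces the [K]-ary lifting sending [r : X -> K -> V] to the column
    [Fhat r (-, t)]. Naturality is the identity [Fhat (s . f) = Fhat s . F f],
    valid for every lax extension ([lax_precomp_graph]), and monotonicity is
    that of [Fhat].

    Through the adjunction of tensor and hom, [Fhat g . Fhat r <= Fhat (g . r)]
    says that [Fhat r] lies below the Kantorovich relation of any family of Moss
    liftings ([le_kantorovich1_moss]). For the reverse bound at [(x, y)], take
    first an element [z = F j t] of [F Y] with [j : K -> Y] and [t : F K].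
    Testing the lifting of [t] against the converse of [j] gives
    [Fhat 1 y z * c x y <= Fhat r x z], where [c] is the Kantorovich relation,
    because [Fhat (j° . r) = (F j)° . Fhat r] ([lax_postcomp_cograph]). Hence
    [c x y * (Fhat 1 y z * Fhat 1 z y) <= Fhat r x y]. Density says that the
    join of the factors [Fhat 1 y z * Fhat 1 z y], over those [z] whose arity
    [K] is smaller than [lambda], is [Fhat 1 y y], which is at least the unit;
    so [c x y <= Fhat r x y].

    Arities can be taken to be subsets of [lambda] ([small_part_factor]), which
    is why a small set of liftings is enough. *)

Set Implicit Arguments.
Unset Strict Implicit.
Unset Printing Implicit Defensive.

Import Order.TTheory.
Local Open Scope classical_set_scope.
Local Open Scope order_scope.

Section QuantaleRelations.
Context {d : Order.disp_t} {V : quantaleType d}.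
Implicit Types (u v w : V) (X Y Z : SET).

Lemma tensorq1 u : u ⊗ kunit = u.
Proof. by rewrite tensorC tensor1q. Qed.

Lemma qbot_le u : qbot <= u.
Proof. exact: qsup_le. Qed.

Lemma qinf_lb (A : set V) u : A u -> qinf A <= u.
Proof. by case: (qinf_infimum A) => + _; apply. Qed.

Lemma tensor_mono_l u v w : v <= w -> v ⊗ u <= w ⊗ u.
Proof. by rewrite !(tensorC _ u); exact: tensor_mono. Qed.

Lemma tensor_bot_le u w : u ⊗ qbot <= w.
Proof. by rewrite qhom_adjoint; exact: qbot_le. Qed.

Lemma vgraph_at X Y (f : X -> Y) x : vgraph V f x (f x) = kunit.
Proof. by rewrite /vgraph asboolT. Qed.

Lemma vcomp_ge X Y Z (s : vrel V Y Z) (r : vrel V X Y) x y z :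
  r x y ⊗ s y z <= (s ∙ r) x z.
Proof. by apply: qsup_ub; exists y. Qed.

Lemma vcomp_graphE X Y Z (s : vrel V Y Z) (f : X -> Y) x z :
  (s ∙ vgraph V f) x z = s (f x) z.
Proof.
apply/le_anti/andP; split.
  apply: qsup_le => _ [y _ <-]; rewrite /vgraph.
  case: asboolP => [<-|_]; first by rewrite tensor1q.
  by rewrite tensorC; exact: tensor_bot_le.
by apply: le_trans (vcomp_ge _ _ x (f x) z); rewrite vgraph_at tensor1q.
Qed.

Lemma vcomp_cographE X Y Z (f : Z -> Y) (r : vrel V X Y) x z :
  ((vgraph V f)^∘ ∙ r) x z = r x (f z).
Proof.
apply/le_anti/andP; split.
  apply: qsup_le => _ [y _ <-]; rewrite /vconv /vgraph.
  by case: asboolP => [<-|_]; [rewrite tensorq1 | exact: tensor_bot_le].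
by apply: le_trans (vcomp_ge _ _ x (f z) z); rewrite /vconv vgraph_at tensorq1.
Qed.

Lemma vcomp_vid_l X Y (r : vrel V X Y) : vid V Y ∙ r = r.
Proof.
have -> : vid V Y = (vgraph V (@id Y))^∘.
  apply/funext => y; apply/funext => y'; rewrite /vid /vconv /vgraph.
  by congr (if _ then _ else _); apply: asbool_equiv_eq; split=> ->.
by apply/funext => x; apply/funext => y; rewrite vcomp_cographE.
Qed.

(** The universal property of the join that computes [a . i . i° . a], in the
    form in which density is applied. *)
Lemma dense_le (C : vcat V) (A : SET) (i : A -> vobj C) x y w :
  dense i ->
  (forall a, vhom C x (i a) ⊗ vhom C (i a) y <= w) -> vhom C x y <= w.
Proof.
move=> i_dense le_w; rewrite i_dense; apply: qsup_le => _ [z _ <-].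
rewrite qhom_adjoint.
apply: qsup_le => _ [a _ <-]; rewrite -qhom_adjoint vcomp_graphE /vconv.
rewrite /vgraph; case: asboolP => [<-|_]; first by rewrite tensor1q; exact: le_w.
by rewrite (tensorC qbot) tensorA; exact: tensor_bot_le.
Qed.

End QuantaleRelations.

Section LaxExtensions.
Context {d : Order.disp_t} {V : quantaleType d} {F : setFunctor}.
Variable Fhat : laxExtension V F.
Implicit Types X Y Z : SET.

Lemma lax_comp_at X Y Z (r : vrel V X Y) (s : vrel V Y Z) x y z :
  lax_map Fhat r x y ⊗ lax_map Fhat s y z <= lax_map Fhat (s ∙ r) x z.
Proof. exact: le_trans (vcomp_ge _ _ _ _ _) (lax_comp _ _ _ _ _). Qed.

Lemma lax_graph_at X Y (f : X -> Y) x :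
  kunit <= lax_map Fhat (vgraph V f) x (fmap F f x).
Proof. by rewrite -(vgraph_at (fmap F f) x); exact: lax_graph. Qed.

Lemma lax_cograph_at X Y (f : X -> Y) x :
  kunit <= lax_map Fhat (vgraph V f)^∘ (fmap F f x) x.
Proof. by rewrite -(vgraph_at (fmap F f) x); exact: lax_cograph. Qed.

Lemma lax_vid_refl X x : kunit <= lax_map Fhat (vid V X) x x.
Proof. by have := lax_graph_at (@id X) x; rewrite fmap_id. Qed.

(** One inequality composes with [Fhat f]; for the other, composing with
    [Fhat f°] only loses the inequality [f . f° <= 1]. *)
Lemma lax_precomp_graph X Y Z (s : vrel V Y Z) (f : X -> Y) x z :
  lax_map Fhat (s ∙ vgraph V f) x z = lax_map Fhat s (fmap F f x) z.
Proof.
apply/le_anti/andP; split.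
  rewrite -[leLHS]tensor1q.
  apply: le_trans (tensor_mono_l _ (lax_cograph_at f x)) _.
  apply: le_trans (lax_comp_at _ _ _ _ _) _.
  apply: lax_mono => y z'; apply: qsup_le => _ [x' _ <-].
  rewrite vcomp_graphE /vconv /vgraph.
  case: asboolP => [<-|_]; first by rewrite tensor1q.
  by rewrite tensorC; exact: tensor_bot_le.
rewrite -[leLHS]tensor1q.
apply: le_trans (tensor_mono_l _ (lax_graph_at f x)) _.
exact: lax_comp_at.
Qed.

(** The dual of [lax_precomp_graph], with the roles of [f] and [f°] exchanged. *)
Lemma lax_postcomp_cograph X Y Z (f : Z -> Y) (r : vrel V X Y) x z :
  lax_map Fhat ((vgraph V f)^∘ ∙ r) x z = lax_map Fhat r x (fmap F f z).
Proof.
apply/le_anti/andP; split.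
  rewrite -[leLHS]tensorq1; apply: le_trans (tensor_mono _ (lax_graph_at f z)) _.
  apply: le_trans (lax_comp_at _ _ _ _ _) _.
  apply: lax_mono => x' y; apply: qsup_le => _ [z' _ <-].
  rewrite vcomp_cographE /vgraph.
  by case: asboolP => [<-|_]; [rewrite tensorq1 | exact: tensor_bot_le].
rewrite -[leLHS]tensorq1; apply: le_trans (tensor_mono _ (lax_cograph_at f z)) _.
exact: lax_comp_at.
Qed.

Definition moss_map (K : SET) (t : F K) X (r : vrel V X K) : vrel V (F X) unit :=
  fun x _ => lax_map Fhat r x t.

Lemma moss_natural (K : SET) (t : F K) X Y (f : X -> Y) (r : vrel V Y K) :
  moss_map t (r ∙ vgraph V f) = moss_map t r ∙ vgraph V (fmap F f).
Proof.
apply/funext => x; apply/funext => -[].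
by rewrite vcomp_graphE /moss_map lax_precomp_graph.
Qed.

Definition moss (K : SET) (t : F K) : predLifting V F :=
  PredLifting (moss_natural t).

Lemma moss_monotone (K : SET) (t : F K) : monotone (moss t).
Proof. by move=> X r r' rr' x u; apply: lax_mono. Qed.

Lemma le_kantorovich1_moss (K : SET) (t : F K) X Y (r : vrel V X Y) :
  lax_map Fhat r ⊑ kantorovich1 (moss t) r.
Proof.
move=> x y; apply: qsup_ub => _ [g _ <-]; apply: qsup_ub => _ [[] _ <-].
by rewrite -qhom_adjoint tensorC; exact: lax_comp_at.
Qed.

(** The instance [g := j°] of the meet defining the Kantorovich relation: it
    turns the lifting of [t] into evaluation at [F j t]. *)
Lemma kantorovich1_moss_le (K : SET) (t : F K) X Y (r : vrel V X Y)
    (j : K -> Y) x y :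
  lax_map Fhat (vid V Y) y (fmap F j t) ⊗ kantorovich1 (moss t) r x y
    <= lax_map Fhat r x (fmap F j t).
Proof.
pose g : vrel V Y (arity (moss t)) := (vgraph V j)^∘.
rewrite qhom_adjoint -(lax_postcomp_cograph j r) -(lax_postcomp_cograph j).
have -> : (vgraph V j)^∘ ∙ vid V Y = g.
  by apply/funext => y'; apply/funext => c; rewrite vcomp_cographE /vid /g
    /vconv /vgraph; congr (if _ then _ else _); apply: asbool_equiv_eq; split=> ->.
apply: (@le_trans _ _ ((pl_map (moss t) g ⧵ pl_map (moss t) (g ∙ r)) x y)).
  by apply: qinf_lb; exists g.
by apply: qinf_lb; exists tt.
Qed.

End LaxExtensions.

(** Relates the two readings of a subset as a cardinal: as a set of elements of
    [T], and as the type that serves as the arity of a lifting. *)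
Lemma card_sig (T : Type) (A : set T) : ([set: {a | A a}] #= A)%card.
Proof.
have imA : range (fun a : {a | A a} => sval a) = A.
  apply/seteqP; split=> [_ [a _ <-]|a Aa]; first exact: svalP.
  by exists (exist _ a Aa).
rewrite -[X in (_ #= X)%card]imA; apply: card_esym.
apply: inj_card_eq => -[a Aa] [b Ab] _ _ /= ab.
exact: eq_exist.
Qed.

(** Any set smaller than [L] injects into [L], so the elements of the small part
    of [F Y] come from subsets of [L]: a small family of arities, independent of
    [Y]. *)
Lemma small_part_factor (F : setFunctor) (L Y : SET) (z : F Y) :
  small_part L z ->
  exists2 B : set L, smaller {b | B b} L &
  exists (j : {b | B b} -> Y) (t : F {b | B b}), z = fmap F j t.
Proof.
case=> A AL [t _ <-].
have /card_leP[f] : (A #<= [set: L])%card by case/andP: AL.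
pose h (a : {a | A a}) : L := val (f (exist _ (sval a) (mem_set (svalP a)))).
have h_inj : injective h.
  move=> [a Aa] [b Ab] /val_inj fab; apply: eq_exist.
  by have /(congr1 val) := inj (mem_set I) (mem_set I) fab.
have eqA : ([set: {b | range h b}] #= A)%card.
  apply: card_eq_trans (card_sig _) (card_eq_trans _ (card_sig A)).
  by apply: inj_card_eq => a b _ _; exact: h_inj.
exists (range h).
  by rewrite /smaller /card_lt (card_le_eql eqA) (card_le_eqr eqA).
pose g (a : {a | A a}) : {b | range h b} := exist _ (h a) (imageT h a).
have pre (b : {b | range h b}) : exists a, h a = sval b.
  by have [a _ ha] := svalP b; exists a.
have [j jP] := choice pre.
exists (fun b => sval (j b)), (fmap F g t).
rewrite -[RHS]/((fmap F _ \o fmap F g) t) -fmap_comp.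
congr (fmap F _ t); apply/funext => a /=; congr sval.
by apply: h_inj; rewrite jP.
Qed.

Theorem corollary5p14 (d : Order.disp_t) (V : quantaleType d) (F : setFunctor)
    (Fhat : laxExtension V F) (lambda : SET)
    (lambda_regular : regular lambda)
    (Flambda_dense : dense_nat (small_inclusion F lambda) Fhat) :
  lambda_small lambda Fhat.
Proof.
(* [lambda -> Prop] is small, whereas [set lambda] lives in the universe of
   [set], which is above [SET] since [set (predLifting V F)] must be formed. *)
pose I : SET :=
  {B : {B : lambda -> Prop | smaller {b | B b} lambda} & F {b | sval B b}}.
pose mu (i : I) := moss Fhat (projT2 i).
exists (range mu); split.
- by exists I, mu.
- by move=> _ [[[B BL] t] _ <-]; split; [exact: moss_monotone | exact: BL].
move=> X Y r; apply/funext => x; apply/funext => y.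
apply/le_anti/andP; split.
  by apply: qsup_ub => _ [_ [i _ <-] <-]; exact: le_kantorovich1_moss.
set c := kantorovich _ _ _ _.
suff le_hom : lax_map Fhat (vid V Y) y y <= qhom c (lax_map Fhat r x y).
  rewrite -[c]tensorq1 qhom_adjoint.
  exact: le_trans (lax_vid_refl _ _) le_hom.
apply: (dense_le (C := lax_vcat Fhat Y) (Flambda_dense Y)) => -[z zL] /=.
have [B BL [j [t ->]]] := small_part_factor zL.
rewrite -qhom_adjoint tensorA (tensorC c).
have le_z : lax_map Fhat (vid V Y) y (fmap F j t) ⊗ c
    <= lax_map Fhat r x (fmap F j t).
  apply: le_trans (kantorovich1_moss_le _ _ _ _ x y); apply: tensor_mono.
  by apply: qinf_lb; exists (mu (existT _ (exist _ B BL) t)).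
apply: le_trans (tensor_mono_l _ le_z) _.
apply: le_trans (lax_comp_at _ _ _ _ _ _) _.
by rewrite vcomp_vid_l.
Qed.
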